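(* Fix $n\ge3$ and let $a^n_\ell$ be the number of fully commutative elements of length $\ell$ in the Coxeter group of type $\widetilde{A}_{n-1}$. The sequence $(a^n_\ell)_{\ell\ge0}$ is ultimately periodic of period $n$. Moreover, periodicity starts at length $\ell_0+1$, where $\ell_0=\lfloor\frac{n-1}{2}\rfloor\lceil\frac{n-1}{2}\rceil$; that is, $a^n_{\ell+n}=a^n_\ell$ for all $\ell\ge\ell_0+1$, while $a^n_{\ell_0+n}\neq a^n_{\ell_0}$.
   Context: The Coxeter group of type $\widetilde{A}_{n-1}$ ($n\ge3$) has generators $s_0,\dots,s_{n-1}$, with $m_{s_is_{i+1}}=3$ for indices modulo $n$, all other pairs of distinct generators commuting. Length means Coxeter length. An element is fully commutative if any of its reduced expressions can be obtained from any other one using only commutation relations between generators. *)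

(* Defs.v *)
From HB Require Import structures.
From Stdlib Require Import Relation_Operators.
From mathcomp Require Import all_boot generic_quotient finmap.
From mathcomp Require Import boolp classical_sets cardinality.

Set Implicit Arguments.
Unset Strict Implicit.
Unset Printing Implicit Defensive.

(* The entry 0 encodes m_{ij} = oo: no relation between s_i and s_j. *)
Record coxeter_matrix (I : finType) := CoxeterMatrix {
  coxm :> I -> I -> nat;
  coxm_diag : forall i, coxm i i = 1;
  coxm_sym : forall i j, coxm i j = coxm j i;
  coxm_offdiag : forall i j, i != j -> coxm i j != 1
}.

Section CoxeterGroup.
Context (I : finType) (m : coxeter_matrix I).

(* (s_i s_j)^{m_ij}; as m_ii = 1, this is s_i s_i when i = j. *)
Definition relator (i j : I) : seq I := flatten (nseq (m i j) [:: i; j]).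

Inductive erase_relator : seq I -> seq I -> Prop :=
  EraseRelator u v i j : erase_relator (u ++ relator i j ++ v) (u ++ v).

Definition coxeter_cong : seq I -> seq I -> Prop :=
  clos_refl_sym_trans _ erase_relator.

Definition coxeter_congb (u v : seq I) : bool := `[< coxeter_cong u v >].

Lemma coxeter_congb_refl : reflexive coxeter_congb.
Proof. by move=> u; apply/asboolP/rst_refl. Qed.

Lemma coxeter_congb_sym : symmetric coxeter_congb.
Proof. by move=> u v; apply/asboolP/asboolP; apply: rst_sym. Qed.

Lemma coxeter_congb_trans : transitive coxeter_congb.
Proof.
by move=> v u w /asboolP uv /asboolP vw; apply/asboolP; exact: rst_trans uv vw.
Qed.

Canonical coxeter_congb_equiv := EquivRel coxeter_congb
  coxeter_congb_refl coxeter_congb_sym coxeter_congb_trans.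

Definition coxeter_group := {eq_quot coxeter_congb}%qT.

HB.instance Definition _ := Choice.on coxeter_group.
HB.instance Definition _ := EqQuotient.on coxeter_group.

Definition coxeter_class (u : seq I) : coxeter_group := \pi_coxeter_group%qT u.

Lemma coxeter_classP u v :
  coxeter_class u = coxeter_class v <-> coxeter_cong u v.
Proof.
split=> [/eqP|uv]; first by rewrite piE => /asboolP.
by apply/eqP; rewrite piE; apply/asboolP.
Qed.

Lemma coxeter_class_repr (x : coxeter_group) : coxeter_class (repr x) = x.
Proof. exact: reprK. Qed.

Lemma coxeter_cong_cat u u' v v' : coxeter_cong u u' -> coxeter_cong v v' ->
  coxeter_cong (u ++ v) (u' ++ v').
Proof.
move=> uu' vv'; apply: (@rst_trans _ _ _ (u' ++ v)).
  elim: uu' => {u u'} [_ _ [a b i j]|u|u u' _ IH|u w u' _ IH1 _ IH2].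
  - by apply: rst_step; rewrite -!catA; constructor.
  - exact: rst_refl.
  - exact: rst_sym.
  - exact: rst_trans IH1 IH2.
elim: vv' => {v v'} [_ _ [a b i j]|v|v v' _ IH|v w v' _ IH1 _ IH2].
- by apply: rst_step; rewrite [u' ++ a ++ _]catA [u' ++ a ++ _]catA; constructor.
- exact: rst_refl.
- exact: rst_sym.
- exact: rst_trans IH1 IH2.
Qed.

Lemma coxeter_cong_catrev u : coxeter_cong (u ++ rev u) [::].
Proof.
elim/last_ind: u => [|u i IH]; first exact: rst_refl.
apply: rst_trans IH; apply: rst_step.
rewrite rev_rcons cat_rcons.
by have := EraseRelator u (rev u) i i; rewrite /relator coxm_diag.
Qed.

Definition coxeter_mul (x y : coxeter_group) : coxeter_group :=
  coxeter_class (repr x ++ repr y).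

Definition coxeter_inv (x : coxeter_group) : coxeter_group :=
  coxeter_class (rev (repr x)).

Lemma coxeter_mulE u v :
  coxeter_mul (coxeter_class u) (coxeter_class v) = coxeter_class (u ++ v).
Proof.
by apply/coxeter_classP/coxeter_cong_cat;
  apply/coxeter_classP; rewrite coxeter_class_repr.
Qed.

Lemma coxeter_mulA : associative coxeter_mul.
Proof.
move=> x y z; rewrite -(coxeter_class_repr x) -(coxeter_class_repr y).
by rewrite -(coxeter_class_repr z) !coxeter_mulE catA.
Qed.

Lemma coxeter_mul1 : left_id (coxeter_class [::]) coxeter_mul.
Proof. by move=> x; rewrite -(coxeter_class_repr x) coxeter_mulE. Qed.

Lemma coxeter_mulr1 : right_id (coxeter_class [::]) coxeter_mul.
Proof. by move=> x; rewrite -(coxeter_class_repr x) coxeter_mulE cats0. Qed.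

Lemma coxeter_mulV :
  left_inverse (coxeter_class [::]) coxeter_inv coxeter_mul.
Proof.
move=> x; rewrite -{2}(coxeter_class_repr x) coxeter_mulE.
apply/coxeter_classP.
by have := coxeter_cong_catrev (rev (repr x)); rewrite revK.
Qed.

Lemma coxeter_mulrV :
  right_inverse (coxeter_class [::]) coxeter_inv coxeter_mul.
Proof.
move=> x; rewrite -{1}(coxeter_class_repr x) coxeter_mulE.
exact/coxeter_classP/coxeter_cong_catrev.
Qed.

HB.instance Definition _ := isGroup.Build coxeter_group
  coxeter_mulA coxeter_mul1 coxeter_mulr1 coxeter_mulV coxeter_mulrV.

Definition coxeter_gen (i : I) : coxeter_group := coxeter_class [:: i].

Definition word_eval (u : seq I) : coxeter_group :=
  (\prod_(i <- u) coxeter_gen i)%g.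

Lemma word_evalE u : word_eval u = coxeter_class u.
Proof.
rewrite /word_eval; elim: u => [|i u IH]; first by rewrite big_nil.
by rewrite big_cons IH [LHS]coxeter_mulE.
Qed.

Lemma word_eval_surj (w : coxeter_group) :
  exists k, [exists t : k.-tuple I, word_eval t == w].
Proof.
exists (size (repr w)); apply/existsP; exists (in_tuple (repr w)).
by rewrite word_evalE coxeter_class_repr.
Qed.

Definition coxeter_length (w : coxeter_group) : nat := ex_minn (word_eval_surj w).

Definition reduced_expr (w : coxeter_group) (u : seq I) : Prop :=
  word_eval u = w /\ size u = coxeter_length w.

Inductive commutation_step : seq I -> seq I -> Prop :=
  CommutationStep u v i j : m i j = 2 ->
    commutation_step (u ++ i :: j :: v) (u ++ j :: i :: v).

Definition commutation_equiv : seq I -> seq I -> Prop :=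
  clos_refl_trans _ commutation_step.

Definition fully_commutative (w : coxeter_group) : Prop :=
  forall u v, reduced_expr w u -> reduced_expr w v -> commutation_equiv u v.

Definition fc_of_length (l : nat) : set coxeter_group :=
  [set w | fully_commutative w /\ coxeter_length w = l].

Lemma finite_fc_of_length l : finite_set (fc_of_length l).
Proof.
apply: (@sub_finite_set _ _ [set word_eval t | t in [set: l.-tuple I]]).
  move=> w [_ <-]; rewrite /coxeter_length.
  by case: ex_minnP => k /existsP[t /eqP wt] _; exists t.
exact/finite_image/finite_finset.
Qed.

(* fset_set A enumerates A only when A is finite, as finite_fc_of_length shows
   here. *)
Definition fc_count (l : nat) : nat := #|` fset_set (fc_of_length l)|.

End CoxeterGroup.

(* ordS is the successor modulo n on 'I_n; this is the matrix of type
   \tilde A_{n-1} for n >= 3 only. *)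
Definition affineA_entry (n : nat) (i j : 'I_n) : nat :=
  if i == j then 1 else if (j == ordS i) || (i == ordS j) then 3 else 2.

Lemma affineA_diag n (i : 'I_n) : affineA_entry i i = 1.
Proof. by rewrite /affineA_entry eqxx. Qed.

Lemma affineA_sym n (i j : 'I_n) : affineA_entry i j = affineA_entry j i.
Proof. by rewrite /affineA_entry eq_sym orbC. Qed.

Lemma affineA_offdiag n (i j : 'I_n) : i != j -> affineA_entry i j != 1.
Proof. by rewrite /affineA_entry => /negPf ->; case: ifP. Qed.

Definition affineA_matrix (n : nat) : coxeter_matrix 'I_n :=
  CoxeterMatrix (@affineA_diag n) (@affineA_sym n) (@affineA_offdiag n).

Definition affineA_fc_count (n l : nat) : nat := fc_count (affineA_matrix n) l.

(* p is a period, not necessarily the least one. *)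
Definition ultimately_periodic (p : nat) (a : nat -> nat) : Prop :=
  0 < p /\ exists N, forall l, N <= l -> a (l + p) = a l.

(* Main.v *)
Require Import Defs.
From Stdlib Require Import Relation_Operators.
From mathcomp Require Import all_boot.
From mathcomp Require Import fingroup perm.
From mathcomp Require Import finmap.
From mathcomp Require Import boolp classical_sets cardinality.
From mathcomp Require Import zify.

Set Implicit Arguments.
Unset Strict Implicit.
Unset Printing Implicit Defensive.

(** Write a word in the generators up to commutations as a heap of beads over
    the n-cycle.  The proof replaces fully commutative elements by integer
    labellings of that cycle, for which the periodicity is visible.

    From elements to words.  The prefix reflections of a word, counted modulo 2,
    depend only on the element; this gives the exchange condition ([exchange])
    and, when all entries off the diagonal are 2 or 3, Matsumoto's theorem
    ([matsumoto]).  Call a word alternating when, for linked generators i and j,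
    two occurrences of i always have a j between them.  No braid i j i can be
    reached from an alternating word by commutations, because between the two
    occurrences of i both neighbours of i occur; by Matsumoto's theorem an
    alternating word is therefore reduced and represents a fully commutative
    element.  Conversely, a word that is not alternating can be turned by
    commutations into one containing i i or i j i ([not_alternating]), so it is
    not a reduced word of a fully commutative element.

    From words to profiles.  For an alternating word, record the number h i of
    occurrences of each generator and, for each edge (i, i + 1) of the cycle,
    whether the first letter among i and i + 1 is i.  By alternation, neighbouring
    values of h differ by at most 1, the smaller count belonging to the letter
    that comes second.  This profile determines the word up to commutations
    ([profile_inj]).  A bit per edge is an orientation of the cycle, and apart from
    the zero profile the profiles that occur are those whose orientation is not
    cyclic: such an orientation has a source, which can be the first letter, and
    one goes on by induction ([heap_profile_realizable]).

    Counting.  Adding 1 to all values of h maps the profiles of sum l injectively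
    to those of sum l + n.  A profile of sum l + n is missed only if h vanishes
    somewhere, which bounds its sum by l0 + n, or if after subtracting 1 some
    edge with two zero ends has its bit set, although neither letter would occur,
    which bounds the remaining sum by l0: with zeros at the ends of a path of n
    vertices, h lies below the tent min(r, n - 1 - r), whose sum is l0.  So the map
    is onto for l > l0; at l = l0 it misses the tent raised by 1 with the bit set
    on the edge joining its two ends. *)

(** * Reflections of a word and the exchange condition *)

Section Words.
Local Open Scope group_scope.
Context (I : finType) (m : coxeter_matrix I).
Implicit Types (i j : I) (u v : seq I) (t w : coxeter_group m).
Local Notation ev := (word_eval m).
Local Notation gen := (coxeter_gen m).

Lemma word_eval_nil : ev [::] = 1.
Proof. by rewrite /word_eval big_nil. Qed.

Lemma word_eval_cons i u : ev (i :: u) = gen i * ev u.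
Proof. by rewrite /word_eval big_cons. Qed.

Lemma word_eval_cat u v : ev (u ++ v) = ev u * ev v.
Proof. by rewrite /word_eval big_cat. Qed.

Lemma word_eval_cong u v : ev u = ev v <-> coxeter_cong m u v.
Proof. by rewrite !word_evalE; exact: coxeter_classP. Qed.

Lemma word_eval_relator i j : ev (relator m i j) = 1.
Proof.
rewrite -word_eval_nil; apply/word_eval_cong/rst_step.
by have := EraseRelator m [::] [::] i j; rewrite !cats0.
Qed.

Lemma coxeter_relation i j : (gen i * gen j) ^+ m i j = 1.
Proof.
rewrite -(word_eval_relator i j) /relator; elim: (m i j) => [|k IH] /=.
  by rewrite word_eval_nil.
by rewrite expgS IH 2!word_eval_cons mulgA.
Qed.

Lemma coxeter_gen_sq i : gen i * gen i = 1.
Proof. by have := coxeter_relation i i; rewrite coxm_diag. Qed.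

Lemma coxeter_genV i : (gen i)^-1 = gen i.
Proof. exact/mulg1_eq/coxeter_gen_sq. Qed.

Lemma coxeter_genK i : involutive (fun t => gen i * t).
Proof. by move=> t; rewrite mulgA coxeter_gen_sq mul1g. Qed.

Lemma coxeter_length_le u : coxeter_length (ev u) <= size u.
Proof.
rewrite /coxeter_length; case: ex_minnP => k _; apply.
by apply/existsP; exists (in_tuple u).
Qed.

Lemma reduced_expr_exists (w : coxeter_group m) : exists u, reduced_expr w u.
Proof.
rewrite /reduced_expr /coxeter_length; case: ex_minnP => k /existsP[u /eqP uw] _.
by exists u; rewrite size_tuple.
Qed.

Definition reduced u := coxeter_length (ev u) == size u.

Lemma reducedP u :
  reflect (forall v, ev v = ev u -> size u <= size v) (reduced u).
Proof.
apply: (iffP eqP) => [<- v <-|min_u]; first exact: coxeter_length_le.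
apply/eqP; rewrite eqn_leq coxeter_length_le /=.
by have [v [vu <-]] := reduced_expr_exists (ev u); apply: min_u.
Qed.

Lemma reduced_exprP w u : reduced_expr w u <-> ev u = w /\ reduced u.
Proof.
by split=> [[<- szu]|[<- /eqP szu]]; split=> //; apply/eqP.
Qed.

Lemma reduced_eq_size u v : ev u = ev v -> reduced u -> reduced v -> size u = size v.
Proof. by rewrite /reduced => -> /eqP <- /eqP. Qed.

Lemma reduced_of_size u v : ev u = ev v -> size u = size v -> reduced u -> reduced v.
Proof. by rewrite /reduced => -> ->. Qed.

Lemma reduced_catl u v : reduced (u ++ v) -> reduced u.
Proof.
move=> /reducedP red; apply/reducedP => x xu.
by rewrite -(leq_add2r (size v)) -!size_cat red // !word_eval_cat xu.
Qed.

Lemma reduced_catr u v : reduced (u ++ v) -> reduced v.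
Proof.
move=> /reducedP red; apply/reducedP => x xv.
by rewrite -(leq_add2l (size u)) -!size_cat red // !word_eval_cat xv.
Qed.

Lemma reduced_behead i u : reduced (i :: u) -> reduced u.
Proof. exact: (@reduced_catr [:: i]). Qed.

Lemma gen_conj_inj i : injective (fun t => gen i * t * (gen i)^-1).
Proof. by move=> t t' /mulIg/mulgI. Qed.

(** The word i1 ... ik yields the elements i1 ... i(r-1) ir i(r-1) ... i1.  These
    are the reflections that undo one letter: multiplying the word on the left by
    the r-th one deletes ir. *)
Fixpoint prefix_reflections u : seq (coxeter_group m) :=
  if u is i :: v
  then gen i :: [seq gen i * t * (gen i)^-1 | t <- prefix_reflections v]
  else [::].

Lemma size_prefix_reflections u : size (prefix_reflections u) = size u.
Proof. by elim: u => //= i u IH; rewrite size_map IH. Qed.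

Lemma prefix_reflections_cat u v :
  prefix_reflections (u ++ v) =
  prefix_reflections u ++ [seq ev u * t * (ev u)^-1 | t <- prefix_reflections v].
Proof.
elim: u => [|i u IH] /=.
  rewrite -[LHS]map_id; apply: eq_map => t.
  by rewrite word_eval_nil mul1g invg1 mulg1.
rewrite IH map_cat -map_comp; congr (_ :: _ ++ _); apply: eq_map => t /=.
by rewrite word_eval_cons invgM !mulgA.
Qed.

Lemma mem_prefix_reflections u t : t \in prefix_reflections u ->
  exists a i b, u = a ++ i :: b /\ t = ev a * gen i * (ev a)^-1.
Proof.
elim: u t => // i u IH t /=; rewrite inE => /predU1P[->|/mapP[r /IH]].
  by exists [::], i, u; rewrite word_eval_nil mul1g invg1 mulg1.
move=> [a [j [b [-> ->]]]] ->; exists (i :: a), j, b.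
by rewrite word_eval_cons invgM !mulgA.
Qed.

Lemma gen_mem_prefix_reflections i u : gen i \in prefix_reflections u ->
  exists a j b, u = a ++ j :: b /\ ev (i :: u) = ev (a ++ b).
Proof.
move=> /mem_prefix_reflections[a [j [b [uab eq_i]]]]; exists a, j, b; split=> //.
have ia_j : gen i * ev a * gen j = ev a.
  by rewrite {1}eq_i mulgVK -mulgA coxeter_gen_sq mulg1.
by rewrite uab word_eval_cons !word_eval_cat word_eval_cons !mulgA ia_j.
Qed.

Lemma mem_gen_conj i (s : seq (coxeter_group m)) :
  (gen i \in [seq gen i * t * (gen i)^-1 | t <- s]) = (gen i \in s).
Proof. by have := mem_map (@gen_conj_inj i) s (gen i); rewrite mulgK. Qed.

(** Each of the 2 m elements is a power of gen i * gen j times gen i, so that the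
    second half of the list repeats the first one by the relation itself. *)
Lemma prefix_reflections_relator i j :
  prefix_reflections (relator m i j) =
  [seq (gen i * gen j) ^+ k * gen i | k <- iota 0 (m i j).*2].
Proof.
rewrite /relator; elim: (m i j) => //= k ->.
rewrite mul1g expg1 coxeter_genV; congr [:: _, _ & _].
rewrite (iotaDl 2 0) -!map_comp; apply: eq_map => r /=.
by rewrite coxeter_genV add2n expgS expgSr !mulgA.
Qed.

(** Parities survive the insertion of a relator: the reflections it adds come in
    equal pairs, and it acts trivially on the reflections of the letters that
    follow. *)
Lemma odd_count_prefix_reflections t u v : ev u = ev v ->
  odd (count_mem t (prefix_reflections u)) =
  odd (count_mem t (prefix_reflections v)).
Proof.
move/word_eval_cong; elim=> {u v} [_ _ [u v i j]|//|//|u w v _ -> _ -> //].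
rewrite !prefix_reflections_cat !map_cat !count_cat word_eval_relator.
have -> : [seq 1 * t * 1^-1 | t <- prefix_reflections v] = prefix_reflections v.
  by rewrite -[RHS]map_id; apply: eq_map => r; rewrite mul1g invg1 mulg1.
rewrite !oddD; congr (_ (+) _); rewrite prefix_reflections_relator -addnn iotaD.
have -> : iota (0 + m i j) (m i j) = [seq m i j + k | k <- iota 0 (m i j)]%N.
  by rewrite -iotaDl addn0.
rewrite !map_cat count_cat oddD -!map_comp.
set s1 := map _ _; set s2 := map _ _; suff -> : s1 = s2 by rewrite addbb.
by apply: eq_map => r /=; rewrite expgnDr coxeter_relation mul1g.
Qed.

(** If the reflections are distinct, each of them occurs an odd number of times in
    every word of the same element, which is then at least as long.  If one is
    repeated, the two letters concerned can be deleted. *)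
Lemma reduced_uniq u : uniq (prefix_reflections u) = reduced u.
Proof.
apply/idP/idP => [uniq_u|].
  apply/reducedP => v vu.
  rewrite -size_prefix_reflections -(size_prefix_reflections v).
  apply: uniq_leq_size => // t tu.
  rewrite -has_pred1 has_count lt0n; apply: contraTneq isT => v0.
  have := odd_count_prefix_reflections t vu.
  by rewrite v0 count_uniq_mem // tu.
elim: u => // i u IH red_u /=; rewrite map_inj_uniq; last exact: gen_conj_inj.
rewrite IH ?(reduced_behead red_u) // andbT.
rewrite mem_gen_conj; apply/negP => /gen_mem_prefix_reflections[a [j [b [uab iu]]]].
move: red_u => /reducedP /(_ _ (esym iu)); rewrite uab /= !size_cat /=; lia.
Qed.

(** As the reflections of u are distinct, a repetition in those of i :: u can only
    come from gen i, which must be a reflection of u. *)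
Lemma exchange i u : reduced u -> ~~ reduced (i :: u) ->
  exists a j b, u = a ++ j :: b /\ ev (i :: u) = ev (a ++ b).
Proof.
rewrite -!reduced_uniq /= map_inj_uniq; last exact: gen_conj_inj.
move=> -> /=; rewrite andbT negbK mem_gen_conj.
exact: gen_mem_prefix_reflections.
Qed.

End Words.

(** * Matsumoto's theorem for simply laced matrices *)

Section SimplyLaced.
Local Open Scope group_scope.
Context (I : finType) (m : coxeter_matrix I).
Hypothesis m_le3 : forall i j, i != j -> m i j = 2 \/ m i j = 3.
Hypothesis gen_inj : injective (coxeter_gen m).
Implicit Types (i j : I) (u v : seq I).
Local Notation ev := (word_eval m).
Local Notation gen := (coxeter_gen m).

Inductive braid_step : seq I -> seq I -> Prop :=
| CommutationBraid u v : commutation_step m u v -> braid_step u v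
| LongBraid u v i j : m i j = 3 ->
    braid_step (u ++ [:: i; j; i] ++ v) (u ++ [:: j; i; j] ++ v).

Definition braid_equiv := clos_refl_trans _ braid_step.

Lemma gen_commute i j : m i j = 2 -> gen i * gen j = gen j * gen i.
Proof.
move=> mij; have := coxeter_relation m i j; rewrite mij expg2 => /mulg1_eq.
by rewrite invgM !coxeter_genV.
Qed.

Lemma gen_braid i j : m i j = 3 -> gen i * gen j * gen i = gen j * gen i * gen j.
Proof.
move=> mij; have := coxeter_relation m i j; rewrite mij expgS expg2 !mulgA.
move=> ijijij; have : gen i * gen j * gen i * (gen j * gen i * gen j) = 1.
  by rewrite !mulgA.
by move/mulg1_eq => <-; rewrite !invgM !coxeter_genV mulgA.
Qed.

(** If i and j commuted, (i j)^3 would be i j, and i = j. *)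
Lemma gen_ncommute i j : i != j -> m i j = 3 -> gen i * gen j <> gen j * gen i.
Proof.
move=> /eqP ij mij cij; apply/ij/gen_inj.
have := coxeter_relation m i j; rewrite mij.
have -> : (gen i * gen j) ^+ 3 = gen i * gen j.
  rewrite expgS expg2 {2}cij !mulgA -[_ * gen j * gen j]mulgA coxeter_gen_sq mulg1.
  by rewrite coxeter_gen_sq mul1g.
by move/mulg1_eq; rewrite coxeter_genV.
Qed.

Lemma braid_equiv_cons i u v : braid_equiv u v -> braid_equiv (i :: u) (i :: v).
Proof.
elim=> {u v} [u v uv|u|u w v _ IH1 _ IH2]; last exact: rt_trans IH1 IH2.
  apply: rt_step; case: uv => {u v} [_ _ [u v j k mjk]|u v j k mjk].
    by apply: CommutationBraid; exact: (CommutationStep (i :: u)).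
  exact: (LongBraid (i :: u)).
exact: rt_refl.
Qed.

(** Induction on the length.  When the first letters s and t differ, exchanging t
    into u, and then s into the result if m s t = 3, produces reduced words of the
    same element that begin with the two sides of the braid relation of s and t.
    Each has its first letter in common with u, with v or with an intermediate
    word, to which the induction hypothesis applies. *)
Lemma matsumoto u v : reduced m u -> reduced m v -> ev u = ev v -> braid_equiv u v.
Proof.
have [k] := ubnP (size u); elim: k u v => // k IH [|s u'] [|t v'] szk red_u red_v uv.
- exact: rt_refl.
- by have := reduced_eq_size uv red_u red_v.
- by have := reduced_eq_size uv red_u red_v.
have IHk x y : size x < size (s :: u') ->
    reduced m x -> reduced m y -> ev x = ev y -> braid_equiv x y.
  by move=> szx; apply: IH; move: szk szx => /=; lia.
have szuv := reduced_eq_size uv red_u red_v.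
have [red_u' red_v'] := (reduced_behead red_u, reduced_behead red_v).
have [eq_st|st] := eqVneq s t.
  move: uv; rewrite eq_st !word_eval_cons => /mulgI uv'.
  by apply/braid_equiv_cons/IHk.
have gen_st : gen s <> gen t by move/gen_inj/eqP; apply/negP.
have tu_v' : ev (t :: s :: u') = ev v'.
  by rewrite word_eval_cons uv word_eval_cons coxeter_genK.
have: ~~ reduced m (t :: s :: u').
  by apply/negP => /(reduced_eq_size tu_v')/(_ red_v'); move: szuv => /=; lia.
(* If the deleted letter is the first one, s, then s = t in the group. *)
case/(exchange red_u) => [[|s1 a] [j [b []]]] [s1E u'E tuE].
  case: gen_st; move: tuE; rewrite !word_eval_cons /= u'E mulgA.
  by move/(canRL (mulgK _)); rewrite mulgV => /mulg1_eq; rewrite coxeter_genV.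
rewrite -{s1}s1E in tuE; set x := a ++ b in tuE.
have {}tuE : ev (s :: x) = ev v' by rewrite -tu_v'.
have sz_x : size (s :: x) = size v'.
  by move: szuv; rewrite u'E /= !size_cat /=; lia.
have red_sx : reduced m (s :: x) by apply: reduced_of_size red_v'.
have v_tsx : braid_equiv (t :: s :: x) (t :: v').
  by apply/braid_equiv_cons/IHk; rewrite // sz_x szuv.
have tsx_u : ev (t :: s :: x) = ev (s :: u').
  by rewrite word_eval_cons tuE -tu_v' word_eval_cons coxeter_genK.
have red_tsx : reduced m (t :: s :: x).
  by apply: reduced_of_size red_u; rewrite // szuv /= -sz_x.
have [mst|mst] := m_le3 st.
  have stx_tsx : ev (s :: t :: x) = ev (t :: s :: x).
    by rewrite !word_eval_cons !mulgA gen_commute.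
  have red_stx : reduced m (s :: t :: x) by apply: reduced_of_size red_tsx.
  have u_stx : braid_equiv (s :: u') (s :: t :: x).
    apply/braid_equiv_cons/IHk => //; first exact: reduced_behead red_stx.
    by move: stx_tsx; rewrite tsx_u !(word_eval_cons m s) => /mulgI.
  apply: rt_trans u_stx _; apply: rt_trans v_tsx; apply: rt_step.
  by apply: CommutationBraid; exact: (CommutationStep [::]).
have stsx_u' : ev (s :: t :: s :: x) = ev u'.
  by rewrite word_eval_cons tsx_u word_eval_cons coxeter_genK.
have: ~~ reduced m (s :: t :: s :: x).
  apply/negP => /(reduced_eq_size stsx_u')/(_ red_u'); move: szuv sz_x => /=; lia.
(* The deleted letter is t, s or in x; the first two give s = t and s t = t s. *)
case/(exchange red_tsx) => [[|y1 [|y2 c]] [r [d []]]] =>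
  [[y1E yE]|[y1E y2E yE]|[y1E y2E xE]] eq_s.
- case: gen_st; move: eq_s; rewrite !word_eval_cons /= -yE word_eval_cons !mulgA.
  move/mulIg; move/(canRL (mulgK _)); rewrite mulgV => /mulg1_eq.
  by rewrite coxeter_genV.
- case: (gen_ncommute st mst); move: eq_s.
  rewrite !word_eval_cons /= -y1E -yE !mulgA.
  by move/mulIg/(canRL (mulgK _)); rewrite coxeter_genV.
rewrite -{y1}y1E -{y2}y2E in eq_s; set z := c ++ d in eq_s.
have {}eq_s : ev (s :: t :: s :: z) = ev (s :: u').
  by rewrite word_eval_cons -[t :: s :: z]/([:: t, s & c] ++ d) -eq_s stsx_u'
             word_eval_cons.
have sz_z : size x = (size z).+1 by rewrite xE !size_cat addnS.
have eq_t : ev (t :: s :: t :: z) = ev (s :: t :: s :: z).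
  by rewrite !word_eval_cons !mulgA (gen_braid mst).
have red_s : reduced m (s :: t :: s :: z).
  by apply: reduced_of_size red_u; rewrite // szuv /= -sz_x /= sz_z.
have red_t : reduced m (t :: s :: t :: z) by apply: reduced_of_size red_s.
have u_sts : braid_equiv (s :: u') (s :: t :: s :: z).
  apply/braid_equiv_cons/IHk => //; first exact: reduced_behead red_s.
  by move: eq_s; rewrite !(word_eval_cons m s) => /mulgI.
have tst_tsx : braid_equiv (t :: s :: t :: z) (t :: s :: x).
  apply/braid_equiv_cons/IHk => //; first by rewrite szuv /= -sz_x /= sz_z.
    exact: reduced_behead red_t.
  by move: eq_t; rewrite eq_s -tsx_u !(word_eval_cons m t) => /mulgI.
apply: rt_trans u_sts _; apply: rt_trans v_tsx; apply: rt_trans tst_tsx.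
by apply: rt_step; exact: (LongBraid [::]).
Qed.

End SimplyLaced.

(** * Alternating words *)

Section Alternating.
Context (I : finType) (m : coxeter_matrix I).
Implicit Types (i j k l : I) (u v : seq I).
Local Notation ev := (word_eval m).
Local Notation comm_equiv := (commutation_equiv m).

Lemma commutation_step_sym u v : commutation_step m u v -> commutation_step m v u.
Proof. by case=> a b i j mij; apply: CommutationStep; rewrite coxm_sym. Qed.

Lemma comm_equiv_sym u v : comm_equiv u v -> comm_equiv v u.
Proof.
elim=> {u v} [u v uv|u|u w v _ IH1 _ IH2].
- exact/rt_step/commutation_step_sym.
- exact: rt_refl.
- exact: rt_trans IH2 IH1.
Qed.

Lemma comm_equiv_catl a u v : comm_equiv u v -> comm_equiv (a ++ u) (a ++ v).
Proof.
elim=> {u v} [_ _ [u v i j mij]|u|u w v _ IH1 _ IH2].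
- by apply: rt_step; rewrite !catA; apply: CommutationStep.
- exact: rt_refl.
- exact: rt_trans IH1 IH2.
Qed.

Lemma comm_equiv_cons i u v : comm_equiv u v -> comm_equiv (i :: u) (i :: v).
Proof. exact: (@comm_equiv_catl [:: i]). Qed.

Lemma comm_equiv_move i a v : (forall k, k \in a -> m i k = 2) ->
  comm_equiv (i :: a ++ v) (a ++ i :: v).
Proof.
elim: a => [|k a IH] ia /=; first exact: rt_refl.
apply: (@rt_trans _ _ _ (k :: i :: a ++ v)).
  by apply: rt_step; apply: (CommutationStep [::]); rewrite ia // mem_head.
by apply/comm_equiv_cons/IH => l la; rewrite ia // inE la orbT.
Qed.

Lemma comm_equiv_perm u v : comm_equiv u v -> perm_eq u v.
Proof.
elim=> {u v} [_ _ [u v i j _]|u|u w v _ uw _ wv] //; last exact: perm_trans uw wv.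
by rewrite perm_cat2l (perm_catCA [:: i] [:: j]).
Qed.

Lemma comm_equiv_eval u v : comm_equiv u v -> ev u = ev v.
Proof.
elim=> {u v} [_ _ [u v i j mij]|//|u w v _ -> _ -> //].
rewrite !word_eval_cat !word_eval_cons !mulgA.
by rewrite -(mulgA _ _ (coxeter_gen _ j)) gen_commute ?mulgA.
Qed.

Lemma first_occurrence i u : i \in u -> exists a b, u = a ++ i :: b /\ i \notin a.
Proof.
elim: u => // k u IH; rewrite inE; case: eqVneq => [<- _|ik /IH[a [b [-> ia]]]].
  by exists [::], u.
by exists (k :: a), b; rewrite inE negb_or ik.
Qed.

(** The first letter of u in {i, j} exists and is i, for i <> j.  Commutations
    cannot change this if i and j are linked. *)
Fixpoint leads i j u :=
  if u is k :: v then (k == i) || (k != j) && leads i j v else false.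

Lemma leads_split i j u : leads i j u ->
  exists a b, [/\ u = a ++ i :: b, i \notin a & j \notin a].
Proof.
elim: u => //= k u IH; case: eqP => [->|/eqP ki] /=.
  by exists [::], u.
case/andP => kj /IH[a [b [-> ia ja]]]; exists (k :: a), b.
by rewrite !inE !negb_or ia ja (eq_sym i) (eq_sym j) ki kj.
Qed.

Lemma leads_cat i j a u : i \notin a -> j \notin a ->
  leads i j (a ++ u) = leads i j u.
Proof.
elim: a => //= k a IH; rewrite !inE !negb_or => /andP[ik ia] /andP[jk ja].
by rewrite eq_sym (negPf ik) eq_sym jk IH.
Qed.

Lemma leads_comm i j u v : i != j -> m i j != 2 -> comm_equiv u v ->
  leads i j u = leads i j v.
Proof.
move=> ij mij; elim=> {u v} [_ _ [u v k l mkl]|//|u w v _ -> _ -> //].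
elim: u => /= [|x u -> //].
have kl_ij : ~~ ((k == i) && (l == j)).
  by apply/negP => /andP[/eqP ki /eqP lj]; rewrite -ki -lj mkl in mij.
have kl_ji : ~~ ((k == j) && (l == i)).
  by apply/negP => /andP[/eqP kj /eqP li]; rewrite -kj -li coxm_sym mkl in mij.
have x_ij x : ~~ ((x == i) && (x == j)).
  by apply/negP => /andP[/eqP xi /eqP xj]; rewrite -xi -xj eqxx in ij.
move: kl_ij kl_ji (x_ij k) (x_ij l).
by case: (k == i); case: (k == j); case: (l == i); case: (l == j).
Qed.

(** By recursion on suffixes: between i and its next occurrence there is every j
    linked to i.  This form makes it easy to remove a first letter. *)
Fixpoint alternating u :=
  if u is i :: v then [forall j, (m i j == 3) ==> ~~ leads i j v] && alternating v
  else true.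

Lemma alternating_consP i u :
  reflect ((forall j, m i j = 3 -> ~~ leads i j u) /\ alternating u)
          (alternating (i :: u)).
Proof.
apply: (iffP andP) => -[H altu]; split=> //.
  by move=> j mij; move/forallP/(_ j)/implyP: H; apply; rewrite mij.
by apply/forallP => j; apply/implyP => /eqP/H.
Qed.

Lemma alternating_catr a u : alternating (a ++ u) -> alternating u.
Proof. by elim: a => //= i a IH /andP[_ /IH]. Qed.

Lemma neq_of_entry i j : m i j != 1 -> i != j.
Proof. by apply: contraNneq => ->; rewrite coxm_diag. Qed.

Lemma alternating_comm u v : comm_equiv u v -> alternating u = alternating v.
Proof.
elim=> {u v} [_ _ [a v k l mkl]|//|u w v _ -> _ -> //].
have kl : k != l by apply: neq_of_entry; rewrite mkl.
elim: a => [|i a IH] /=.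
  have E x y : x != y -> m x y = 2 -> forall j, m x j = 3 ->
      leads x j (y :: v) = leads x j v.
    move=> xy mxy j mxj /=; rewrite eq_sym (negPf xy) /=.
    by case: eqVneq mxj => //= <-; rewrite mxy.
  rewrite !andbA; congr (_ && _); rewrite andbC; congr (_ && _).
    apply: eq_forallb => j; case: eqP => //= mlj.
    by congr negb; symmetry; apply: E; rewrite // 1?eq_sym // coxm_sym.
  by apply: eq_forallb => j; case: eqP => //= mkj; congr negb; exact: E.
rewrite IH; congr (_ && _); apply: eq_forallb => j; case: eqP => //= mij.
have ij : i != j by apply: neq_of_entry; rewrite mij.
congr negb; apply: leads_comm => //; first by rewrite mij.
exact/rt_step/CommutationStep.
Qed.

Lemma alternating_separated i k a u : m k i = 3 -> alternating (k :: a ++ k :: u) ->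
  (i \in a) || (k \in a).
Proof.
move=> mki /alternating_consP[/(_ i mki) nlead _]; move: nlead.
apply: contraNT; rewrite negb_or => /andP[ia ka].
by rewrite leads_cat //= eqxx.
Qed.

End Alternating.

(** * Alternating words are the reduced words of fully commutative elements *)

Section TwoRegular.
Context (I : finType) (m : coxeter_matrix I) (prv nxt : I -> I).
Hypothesis m_le3 : forall i j, i != j -> m i j = 2 \/ m i j = 3.
Hypothesis gen_inj : injective (coxeter_gen m).
Hypothesis linkedP : forall i j, m i j = 3 <-> j = prv i \/ j = nxt i.
Hypothesis prv_nxt : forall i, prv i != nxt i.
Implicit Types (i j k l : I) (u v : seq I) (w : coxeter_group m).
Local Notation ev := (word_eval m).
Local Notation comm_equiv := (commutation_equiv m).

Lemma other_neighbour i j : m i j = 3 ->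
  exists k, [/\ k != j, m i k = 3 & forall l, m i l = 3 -> l = j \/ l = k].
Proof.
move/linkedP=> [->|->]; [exists (nxt i) | exists (prv i)]; split.
- by rewrite eq_sym.
- by apply/linkedP; right.
- by move=> l /linkedP.
- by [].
- by apply/linkedP; left.
- by move=> l /linkedP[] ->; [right|left].
Qed.

Lemma neighbour_neq i j : m i j = 3 -> i != j.
Proof. by move=> mij; apply: (@neq_of_entry _ m); rewrite mij. Qed.

(** The second neighbour of i is missing between the two occurrences of i. *)
Lemma alternating_no_braid a i j b : m i j = 3 ->
  ~~ alternating m (a ++ [:: i; j; i] ++ b).
Proof.
move=> mij; apply/negP => /alternating_catr /alternating_consP[H _].
have [k [kj mik _]] := other_neighbour mij.
by have := H k mik; rewrite /= eqxx /= andbT (eq_sym j k) kj orbT.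
Qed.

Lemma alternating_braid_equiv u v : alternating m u -> braid_equiv m u v ->
  comm_equiv u v.
Proof.
move=> alt_u uv; elim: uv alt_u => {u v}.
- move=> _ _ [u v uv _|a b i j mij]; first exact: rt_step.
  by move/negP: (alternating_no_braid a b mij).
- by move=> u _; exact: rt_refl.
- move=> u w v _ IH1 _ IH2 alt_u; have uw := IH1 alt_u.
  by apply: (rt_trans _ _ _ _ _ uw); apply: IH2; rewrite -(alternating_comm uw).
Qed.

(** For a shortest counterexample i :: u, the exchange condition gives a reduced
    word of the element of u that begins with i.  It is reached from u by
    commutations alone, so i leads in u, which alternation of i :: u excludes. *)
Lemma alternating_reduced u : alternating m u -> reduced m u.
Proof.
elim: u => [_|i u IH alt_iu].
  by apply/reducedP.
have /alternating_consP[nlead alt_u] := alt_iu.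
apply: contraT => nred.
have [a [j [b [uE iuE]]]] := exchange (IH alt_u) nred.
have iab_u : ev (i :: a ++ b) = ev u.
  by rewrite word_eval_cons -iuE word_eval_cons coxeter_genK.
have red_iab : reduced m (i :: a ++ b).
  by apply: reduced_of_size (IH alt_u) => //; rewrite uE /= !size_cat addnS.
have /(alternating_braid_equiv alt_u) comm :=
  matsumoto m_le3 gen_inj (IH alt_u) red_iab (esym iab_u).
have mi : m i (nxt i) = 3 by apply/linkedP; right.
have := nlead _ mi; rewrite (leads_comm _ _ comm) ?mi ?neighbour_neq //=.
by rewrite eqxx.
Qed.

Lemma unlinked i k j1 j2 : (forall l, m i l = 3 -> l = j1 \/ l = j2) ->
  k != i -> k != j1 -> k != j2 -> m i k = 2.
Proof.
move=> nbr ki kj1 kj2; have [||/nbr[kj|kj]] // := m_le3 (i := i) (j := k).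
- by rewrite eq_sym.
- by rewrite kj eqxx in kj1.
- by rewrite kj eqxx in kj2.
Qed.

(** Let i :: u be the shortest suffix that is not alternating: the next i comes
    before one of the neighbours, j.  As u is alternating, the other neighbour k
    occurs at most once before that i, since two occurrences of k would be
    separated by i.  The other letters before it commute with i and move out. *)
Lemma not_alternating u : ~~ alternating m u ->
  exists a i b, comm_equiv u (a ++ [:: i; i] ++ b) \/
    exists2 j, m i j = 3 & comm_equiv u (a ++ [:: i; j; i] ++ b).
Proof.
elim: u => // i u IH.
have [alt_u|/IH[a [k [b H]]] _] := boolP (alternating m u); last first.
  exists (i :: a), k, b; case: H => [H|[j mkj H]]; [left|right; exists j => //];
  exact: comm_equiv_cons.
rewrite /= alt_u andbT negb_forall => /existsP[j]; rewrite negb_imply negbK.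
case/andP=> /eqP mij /leads_split[v1 [v2 [uE iv1 jv1]]].
have [k [kj mik nbr]] := other_neighbour mij.
have far l x : k \notin x -> {subset x <= v1} -> l \in x -> m i l = 2.
  move=> kx xv lx; apply: (unlinked nbr).
  - by apply: contraNneq iv1 => <-; exact: xv.
  - by apply: contraNneq jv1 => <-; exact: xv.
  - by apply: contraNneq kx => <-.
(* Without k before the next i, the two occurrences of i become adjacent. *)
have [kv1|kv1] := boolP (k \in v1); last first.
  exists v1, i, v2; left; rewrite uE; apply: comm_equiv_move => l.
  exact: far.
have [x [y [v1E kx]]] := first_occurrence kv1; subst v1.
have mki : m k i = 3 by rewrite coxm_sym.
move: iv1; rewrite mem_cat inE !negb_or => /and3P[ix ik iy].
have ky : k \notin y.
  apply/negP => /first_occurrence[y1 [y2 [yE ky1]]].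
  move: alt_u; rewrite uE yE -!catA /= -catA => /alternating_catr.
  move=> /(alternating_separated mki); rewrite (negPf ky1) orbF => iy1.
  by move: iy; rewrite yE mem_cat iy1.
exists x, i, (y ++ v2); right; exists k => //.
rewrite uE -catA /=; apply: (@rt_trans _ _ _ (x ++ i :: k :: y ++ i :: v2)).
  apply: comm_equiv_move => l; apply: far => // r rx.
  by rewrite mem_cat rx.
apply/comm_equiv_catl/comm_equiv_cons/comm_equiv_cons/comm_equiv_sym.
apply: comm_equiv_move => l; apply: far => // r ry.
by rewrite mem_cat inE ry !orbT.
Qed.

Lemma not_reduced_double a i b : ~~ reduced m (a ++ [:: i; i] ++ b).
Proof.
apply/negP => /reduced_catr /reduced_catl /reducedP /(_ [::]).
rewrite word_eval_nil !word_eval_cons word_eval_nil mulg1 coxeter_gen_sq.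
by move/(_ erefl).
Qed.

(** Two equal adjacent letters contradict reducedness; a braid i j i could be
    replaced by j i j, which changes the number of i and so leaves the
    commutation class. *)
Lemma fully_commutative_alternating w u :
  fully_commutative w -> reduced_expr w u -> alternating m u.
Proof.
move=> fc wu; apply: contraT => /not_alternating[a [i [b H]]].
have red v : comm_equiv u v -> @reduced_expr _ m w v.
  move=> uv; case: wu => <- szu; split; first by rewrite (comm_equiv_eval uv).
  by rewrite -szu (perm_size (comm_equiv_perm uv)).
case: H => [/red /reduced_exprP[_ redv]|[j mij /red wv]].
  by have := not_reduced_double a i b; rewrite redv.
have wv' : reduced_expr w (a ++ [:: j; i; j] ++ b).
  case: wv => <- szv; split; last by rewrite -szv !size_cat.
  rewrite !word_eval_cat; congr (_ * (_ * _))%g.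
  by rewrite !word_eval_cons word_eval_nil !mulg1 !mulgA (gen_braid mij).
have /comm_equiv_perm/seq.permP/(_ (pred1 i)) := fc _ _ wv wv'.
rewrite !count_cat /= eqxx eq_sym (negPf (neighbour_neq mij)); lia.
Qed.

Lemma alternating_fully_commutative u : alternating m u -> fully_commutative (ev u).
Proof.
move=> alt_u; have red_u := alternating_reduced alt_u.
have comm v : reduced_expr (ev u) v -> comm_equiv u v.
  move/reduced_exprP=> [vu red_v]; apply: alternating_braid_equiv => //.
  exact: matsumoto.
move=> v v' /comm uv /comm uv'; apply: rt_trans uv'; exact: comm_equiv_sym.
Qed.

End TwoRegular.

(** * The cycle of generators and its permutation representation *)

Section AffineA.
Variables (n : nat) (hn : 3 <= n).
Implicit Types (i j k : 'I_n).
Local Notation m := (affineA_matrix n).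

Lemma ordS_val i : ordS i = (if i.+1 == n then 0 else i.+1) :> nat.
Proof.
rewrite /=; case: eqP => [->|/eqP ne]; first exact: modnn.
by rewrite modn_small // ltn_neqAle ne ltn_ord.
Qed.

Lemma ordS_neq i : ordS i != i.
Proof. by apply/eqP => Si; have := ordS_val i; rewrite Si; case: eqP; lia. Qed.

Lemma ord_pred_neq i : ord_pred i != i.
Proof. by rewrite -(inj_eq (@ordS_inj n)) ord_predK eq_sym ordS_neq. Qed.

Lemma ordS2_neq i : ordS (ordS i) != i.
Proof.
apply/eqP => SSi; have := ordS_val (ordS i); rewrite SSi ordS_val.
by do 2 case: eqP; lia.
Qed.

Lemma ord_pred_ordS_neq i : ord_pred i != ordS i.
Proof. by rewrite -(inj_eq (@ordS_inj n)) ord_predK eq_sym ordS2_neq. Qed.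

Lemma ord_pred_eq i j : (i == ordS j) = (j == ord_pred i).
Proof. by rewrite -(inj_eq (@ordS_inj n) j) ord_predK eq_sym. Qed.

Lemma affineA_entry3P i j : m i j = 3 <-> j = ord_pred i \/ j = ordS i.
Proof.
rewrite /= /affineA_entry (ord_pred_eq i j); case: eqVneq => [<-|ij].
  by split=> // -[] /eqP; rewrite -?ord_pred_eq eq_sym (negPf (ordS_neq i)).
case: eqP => [->|jS] /=; first by split=> [_|//]; right.
case: eqP => [->|jP] /=; first by split=> [_|//]; left.
by split=> // -[].
Qed.

Lemma affineA_le3 i j : i != j -> m i j = 2 \/ m i j = 3.
Proof. by rewrite /= /affineA_entry => /negPf->; case: ifP; [right|left]. Qed.

Lemma iter_ordS_val r i : iter r (@ordS n) i = (i + r) %% n :> nat.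
Proof.
elim: r => [|r IH]; first by rewrite addn0 modn_small.
by rewrite iterS /= IH addnS -[(_ %% _).+1]addn1 modnDml addn1.
Qed.

(** Successors of i reach the whole cycle. *)
Lemma cycle_ind (P : 'I_n -> Prop) i :
  P i -> (forall j, P j -> P (ordS j)) -> forall j, P j.
Proof.
move=> Pi PS j.
have -> : j = iter (j + (n - i)) (@ordS n) i.
  apply: val_inj; rewrite /= iter_ordS_val addnCA subnKC; last exact/ltnW.
  by rewrite modnDr modn_small.
by elim: (j + _) => // r IH; rewrite iterS; apply: PS.
Qed.

Section Permutation.
Local Open Scope group_scope.

Definition cyclic_tperm i : {perm 'I_n} := tperm i (ordS i).

Definition perm_eval (u : seq 'I_n) : {perm 'I_n} := \prod_(i <- u) cyclic_tperm i.

Lemma cyclic_tperm_far i j : m i j = 2 -> commute (cyclic_tperm i) (cyclic_tperm j).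
Proof.
rewrite /= /affineA_entry; case: eqVneq => // ij; case: eqVneq => //= jS.
case: eqVneq => // iS _; apply/commgP/conjg_fixP.
rewrite /cyclic_tperm tpermJ !tpermD // eq_sym // (inj_eq (@ordS_inj n)) //.
Qed.

Lemma cyclic_tperm_near i : (cyclic_tperm i * cyclic_tperm (ordS i)) ^+ 3 = 1.
Proof.
set a := cyclic_tperm i; set b := cyclic_tperm (ordS i).
have bab : b ^ a = a ^ b.
  rewrite /a /b /cyclic_tperm !tpermJ tpermR tpermL.
  by rewrite !tpermD // ?ordS2_neq // ?ordS_neq // eq_sym ?ordS2_neq ?ordS_neq.
have [a2 b2] : a * a = 1 /\ b * b = 1 by rewrite /a /b /cyclic_tperm !tperm2.
have [aV bV] : a^-1 = a /\ b^-1 = b by rewrite /a /b /cyclic_tperm !tpermV.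
(* The conjugates are one and the same transposition. *)
have -> : (a * b) ^+ 3 = b ^ a * a ^ b.
  by rewrite expgS expg2 /conjg aV bV !mulgA.
by rewrite bab /conjg bV !mulgA -[b * a * b * b]mulgA b2 mulg1 -[b * a * a]mulgA
           a2 mulg1.
Qed.

Lemma perm_eval_relator i j : perm_eval (relator m i j) = 1.
Proof.
have -> : perm_eval (relator m i j) = (cyclic_tperm i * cyclic_tperm j) ^+ m i j.
  rewrite /perm_eval /relator; elim: (m i j) => [|r IH]; first by rewrite big_nil.
  by rewrite expgS -IH /= !big_cons mulgA.
have [->|ij] := eqVneq i j; first by rewrite coxm_diag expg1 /cyclic_tperm tperm2.
have [mij|mij] := affineA_le3 ij; rewrite mij.
  by rewrite (expgMn 2 (cyclic_tperm_far mij)) !expg2 /cyclic_tperm !tperm2 mulg1.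
move/affineA_entry3P: mij => [->|->]; last exact: cyclic_tperm_near.
have := cyclic_tperm_near (ord_pred i); rewrite ord_predK => /(congr1 invg).
by rewrite invg1 -expVgn invMg /cyclic_tperm !tpermV.
Qed.

(** The generators are told apart by the morphism to the symmetric group that
    sends i to the transposition of i and i + 1. *)
Lemma affineA_gen_inj : injective (coxeter_gen m).
Proof.
have cong u v : coxeter_cong m u v -> perm_eval u = perm_eval v.
  elim=> {u v} [_ _ [u v i j]|//|//|u w v _ -> _ -> //].
  by rewrite /perm_eval !big_cat /= [X in _ * (X * _)](perm_eval_relator i j) mul1g.
move=> i j /coxeter_classP/cong; rewrite /perm_eval !big_seq1 => /permP/(_ i).
rewrite /cyclic_tperm tpermL; case: tpermP => [//|iSj|_ _ /eqP].
  by move=> /eqP; rewrite iSj (negPf (ordS2_neq j)).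
by rewrite (negPf (ordS_neq i)).
Qed.

End Permutation.

(** * Profiles of words *)

Local Notation comm_equiv := (commutation_equiv m).
Local Notation profiles := ({ffun 'I_n -> nat} * {ffun 'I_n -> bool})%type.
Implicit Types (u v : seq 'I_n) (d : profiles).

Definition profile u : profiles :=
  ([ffun i => count_mem i u], [ffun i => leads i (ordS i) u]).

(** The constraint on an edge whose ends have a and b occurrences, f telling that
    the first end comes first.  An alternating sequence of two letters has equal
    counts or one more of the letter that comes first; f is false for an edge
    without occurrences. *)
Definition step_ok (a b : nat) (f : bool) :=
  if f then [&& 0 < a, b <= a & a <= b.+1] else (a <= b <= a.+1).

(** An orientation f that is constant is a directed cycle, for which no letter
    could come first.  The zero profile is the only one without an edge where f
    is true. *)
Definition heap_profile d :=
  [/\ forall i, step_ok (d.1 i) (d.1 (ordS i)) (d.2 i),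
      exists i, ~~ d.2 i
    & 0 < \sum_i d.1 i -> exists i, d.2 i].

(** The effect on profiles of removing a first letter i: on both edges at i, the
    neighbour now comes first, if it occurs. *)
Definition pop i d : profiles :=
  ([ffun j => d.1 j - (j == i)],
   [ffun j => if j == i then false
              else if j == ord_pred i then 0 < d.1 j else d.2 j]).

Lemma entry_next i : m i (ordS i) = 3.
Proof. by apply/affineA_entry3P; right. Qed.

Lemma entry_prev i : m i (ord_pred i) = 3.
Proof. by apply/affineA_entry3P; left. Qed.

Lemma entry_next_sym i : m (ordS i) i = 3.
Proof. by rewrite coxm_sym entry_next. Qed.

Lemma leads_asym i j u : i != j -> leads i j u -> ~~ leads j i u.
Proof.
move=> ij; elim: u => //= k u IH; case: eqVneq => [->|ki] /=.
  by rewrite (negPf ij).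
by case/andP=> kj /IH; rewrite (negPf kj).
Qed.

Lemma leads_total i j u : ~~ leads i j u -> leads j i u = (j \in u).
Proof.
elim: u => //= k u IH; rewrite inE negb_or => /andP[ki]; rewrite ki (eq_sym j).
by case: eqVneq => //= kj /IH.
Qed.

Lemma leads_mem i j u : leads i j u -> i \in u.
Proof. by move=> /leads_split[a [b [-> _ _]]]; rewrite mem_cat mem_head orbT. Qed.

Lemma leads_catl i j a u : i \in a -> j \notin a -> leads i j (a ++ u).
Proof.
elim: a => //= k a IH; rewrite !inE negb_or eq_sym => ia /andP[jk ja].
by rewrite (eq_sym k j) jk; case/orP: ia => [->//|ia]; rewrite IH // orbT.
Qed.

Lemma sum_count_mem u : \sum_i count_mem i u = size u.
Proof.
elim: u => [|k u IH] /=; first by rewrite big1.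
rewrite big_split /= IH (bigD1 k) //= eqxx big1 // => i.
by rewrite eq_sym => /negPf->.
Qed.

Lemma profile_comm u v : comm_equiv u v -> profile u = profile v.
Proof.
move=> uv; congr pair; apply/ffunP => i; rewrite !ffunE.
  by apply/seq.permP/comm_equiv_perm/uv.
apply: leads_comm uv; first by rewrite eq_sym ordS_neq.
by rewrite entry_next.
Qed.

Lemma profile_pop i u : alternating m (i :: u) ->
  profile u = pop i (profile (i :: u)).
Proof.
case/alternating_consP=> nlead _; congr pair; apply/ffunP => j; rewrite !ffunE /=.
  by rewrite eq_sym addKn.
case: eqVneq => [->|ji]; first exact/negbTE/nlead/entry_next.
rewrite -ord_pred_eq; case: eqVneq => [iS|//].
have := leads_total (nlead _ (entry_prev i)).
by rewrite iS ordSK => ->; rewrite add0n -has_count has_pred1.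
Qed.

(** * Alternating words up to commutations are heap profiles *)

Lemma alternating_heap_profile u : alternating m u -> heap_profile (profile u).
Proof.
have i0 : 'I_n by exists 0; lia.
move=> alt_u; split; first last.
- under eq_bigr => i _ do rewrite ffunE; rewrite sum_count_mem.
  by case: u alt_u => // i u _ _; exists i; rewrite ffunE /= eqxx.
- case: u alt_u => [|i u] _; first by exists i0; rewrite ffunE.
  exists (ord_pred i); rewrite ffunE /= ord_predK eqxx orbF.
  by rewrite -(inj_eq (@ordS_inj n)) ord_predK ordS_neq.
elim: u alt_u => [|i u IH]; first by move=> _ j; rewrite !ffunE.
case/alternating_consP=> nlead /IH{}IH j; have := IH j; rewrite !ffunE /=.
have [<-|ij] := eqVneq i j.
  rewrite eq_sym (negPf (ordS_neq i)) /= /step_ok.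
  by have := nlead _ (entry_next i); case: (leads i _ u) => //; lia.
have [iS|//] := eqVneq i (ordS j); rewrite /= /step_ok.
have mij : m i j = 3 by rewrite iS entry_next_sym.
have lead_j := leads_total (nlead _ mij); rewrite -iS lead_j.
have [ju|ju] := boolP (j \in u); first lia.
have iu : i \notin u.
  by rewrite -(@leads_total j i) ?lead_j // (negPf (nlead _ mij)).
by rewrite (count_memPn ju) (count_memPn iu).
Qed.

(** The first letter i of u leads both its neighbours in u, hence in v as well: it
    can be moved to the front of v and cancelled. *)
Lemma profile_inj u v : alternating m u -> alternating m v ->
  profile u = profile v -> comm_equiv u v.
Proof.
elim: u v => [|i u IH] v alt_u alt_v uv.
  have: size v = 0.
    rewrite -sum_count_mem big1 // => i _.
    by move/(congr1 (fun d => d.1 i)): uv; rewrite !ffunE.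
  by move/size0nil=> ->; exact: rt_refl.
have lead_v : leads i (ordS i) v.
  by move/(congr1 (fun d => d.2 i)): uv; rewrite !ffunE /= eqxx.
have nlead_v : ~~ leads (ord_pred i) i v.
  move/(congr1 (fun d => d.2 (ord_pred i))): uv; rewrite !ffunE /= ord_predK => <-.
  by rewrite eqxx -(inj_eq (@ordS_inj n)) ord_predK (negPf (ordS_neq i)).
have [a [b [vE ia Sa]]] := leads_split lead_v.
have pa : ord_pred i \notin a.
  by apply: contraNN nlead_v => pa; rewrite vE leads_catl.
have v_iab : comm_equiv (i :: a ++ b) v.
  rewrite vE; apply: comm_equiv_move => k ka.
  have ik : i != k by apply: contraNneq ia => ->.
  have [//|/affineA_entry3P[kE|kE]] := affineA_le3 ik.
    by rewrite -kE ka in pa.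
  by rewrite -kE ka in Sa.
apply: rt_trans (v_iab); apply: comm_equiv_cons.
have alt_iab : alternating m (i :: a ++ b) by rewrite (alternating_comm v_iab).
apply: IH.
- by have /alternating_consP[] := alt_u.
- by have /alternating_consP[] := alt_iab.
- by rewrite (profile_pop alt_u) (profile_pop alt_iab) (profile_comm v_iab) uv.
Qed.

(** Otherwise an edge where f is false would be followed by another such edge, and
    f would be false around the cycle. *)
Lemma heap_profile_source d : heap_profile d -> 0 < \sum_i d.1 i ->
  exists2 i, d.2 i & ~~ d.2 (ord_pred i).
Proof.
case=> _ [j nj] pos /pos[i di].
apply: contrapT => no_source; suff : ~~ d.2 i by rewrite di.
apply: (cycle_ind (P := fun k => ~~ d.2 k) nj) => k nk.
by apply/negP => dSk; apply: no_source; exists (ordS k); rewrite // ordSK.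
Qed.

(** The edge from i has f false afterwards.  If f became false everywhere, the
    counts would be nondecreasing around the cycle, hence constant, and equal to
    the count of the predecessor of i, which would be 0. *)
Lemma heap_profile_pop i d : heap_profile d -> d.2 i -> ~~ d.2 (ord_pred i) ->
  heap_profile (pop i d).
Proof.
case=> ok _ _ di dp.
have pi := ord_pred_neq i.
have ok_i := ok i; have ok_p := ok (ord_pred i).
rewrite /step_ok di in ok_i; rewrite /step_ok (negPf dp) ord_predK in ok_p.
have ok' j : step_ok ((pop i d).1 j) ((pop i d).1 (ordS j)) ((pop i d).2 j).
  rewrite !ffunE; have [->|ji] := eqVneq j i.
    by rewrite (negPf (ordS_neq i)) /step_ok; lia.
  have [->|jp] := eqVneq j (ord_pred i).
    by rewrite ord_predK eqxx /step_ok; case: ifP; lia.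
  by rewrite eq_sym ord_pred_eq (negPf jp) !subn0.
split=> //; first by exists i; rewrite ffunE eqxx.
move=> pos; apply: contrapT => none.
have incr j : (pop i d).1 j <= (pop i d).1 (ordS j).
  have := ok' j; rewrite /step_ok; case: ifP => [dj|_ /andP[] //].
  by case: none; exists j.
have p0 : (pop i d).1 (ord_pred i) = 0.
  case: (posnP (d.1 (ord_pred i))) => [|dp0]; first by rewrite ffunE => ->.
  by case: none; exists (ord_pred i); rewrite ffunE (negPf pi) eqxx.
suff zero j : (pop i d).1 j = 0 by move: pos; rewrite big1.
apply/eqP; rewrite -leqn0 -p0; move: (ord_pred i).
apply: (cycle_ind (i := j)) => // k; move/leq_trans; apply; exact: incr.
Qed.

Lemma sum_pop i d : 0 < d.1 i -> \sum_j d.1 j = (\sum_j (pop i d).1 j).+1.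
Proof.
move=> di; rewrite (bigD1 i) // [in RHS](bigD1 i) //= ffunE eqxx.
under [in RHS]eq_bigr => j ji do rewrite ffunE (negPf ji) subn0.
by rewrite subn1 -addSn prednK.
Qed.

(** Any source i of the orientation may be taken as the first letter; the profile
    without it is again a heap profile. *)
Lemma heap_profile_realizable d : heap_profile d ->
  exists2 u, alternating m u & profile u = d.
Proof.
move sz: (\sum_i d.1 i) => s; elim: s d sz => [|s IH] d sz hd.
  exists [::] => //; case: hd => ok _ _.
  have h0 i : d.1 i = 0 by move/eqP: sz; rewrite sum_nat_eq0 => /forallP/(_ i)/eqP.
  case: d ok h0 {sz} => h f /= ok h0.
  congr pair; apply/ffunP => i; rewrite ffunE ?h0 //.
  by have := ok i; rewrite /step_ok !h0; case: (f i).
have [|i di dp] := heap_profile_source hd; first by rewrite sz.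
have [ok _ _] := hd; have := ok i; rewrite /step_ok di => /and3P[pos _ _].
have dp0 := ok (ord_pred i); rewrite /step_ok (negPf dp) ord_predK in dp0.
have pi := ord_pred_neq i.
have [||u alt_u uE] := IH (pop i d).
- by move: sz; rewrite (sum_pop pos) => -[].
- exact: heap_profile_pop.
have cnt j : count_mem j u = d.1 j - (j == i).
  by move/(congr1 (fun d => d.1 j)): uE; rewrite !ffunE.
have lead j : leads j (ordS j) u =
    (if j == i then false else if j == ord_pred i then 0 < d.1 j else d.2 j).
  by move/(congr1 (fun d => d.2 j)): uE; rewrite !ffunE.
exists (i :: u).
  apply/alternating_consP; split=> // j /affineA_entry3P[->|->]; last first.
    by rewrite lead eqxx.
  have := lead (ord_pred i); rewrite (negPf pi) eqxx ord_predK => lead_p.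
  have [p0|p0] := posnP (d.1 (ord_pred i)); last first.
    by apply: leads_asym; rewrite // lead_p.
  apply: contraTN isT => /leads_mem.
  by rewrite -has_pred1 has_count cnt eqxx; lia.
rewrite [RHS]surjective_pairing; congr pair; apply/ffunP => j; rewrite !ffunE /=.
  by rewrite cnt eq_sym; case: eqVneq => [->|_]; rewrite ?subn0 // subnKC.
rewrite lead ord_pred_eq; case: eqVneq => [<-|ij] /=; first by rewrite di.
by case: eqVneq => [->|_] //=; rewrite (negPf dp).
Qed.

(** * Counting profiles of a given sum *)

Definition profiles_of_sum l : set profiles :=
  [set d | heap_profile d /\ \sum_i d.1 i = l]%classic.

Definition reduced_word (w : coxeter_group m) : seq 'I_n :=
  projT1 (cid (reduced_expr_exists w)).

Lemma reduced_wordP w : reduced_expr w (reduced_word w).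
Proof. by rewrite /reduced_word; case: cid. Qed.

Lemma fc_profile_image l :
  [set profile (reduced_word w) | w in @fc_of_length _ m l]%classic =
  profiles_of_sum l.
Proof.
apply/seteqP; split=> [_ [w [fc <-] <-]|d [hd dl]] /=.
  have red := reduced_wordP w; split.
    apply: alternating_heap_profile.
    exact: (fully_commutative_alternating affineA_le3 affineA_entry3P
              ord_pred_ordS_neq fc).
  under eq_bigr => i _ do rewrite ffunE.
  by rewrite sum_count_mem; case: red.
have [u alt_u uE] := heap_profile_realizable hd.
have len_u : coxeter_length (word_eval m u) = size u.
  apply/eqP/(alternating_reduced affineA_le3 affineA_gen_inj affineA_entry3P) => //.
  exact: ord_pred_ordS_neq.
have fc_u : fully_commutative (word_eval m u).
  apply: (alternating_fully_commutative affineA_le3 affineA_gen_inj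
            affineA_entry3P) => //.
  exact: ord_pred_ordS_neq.
exists (word_eval m u); first split=> //.
  rewrite len_u -dl -uE -sum_count_mem.
  by apply: eq_bigr => i _; rewrite ffunE.
rewrite -uE; apply: profile_comm; apply: fc_u; first exact: reduced_wordP.
by split.
Qed.

Lemma fc_profile_inj l :
  {in @fc_of_length _ m l &, injective (fun w => profile (reduced_word w))}.
Proof.
move=> w w' /set_mem[fc _] /set_mem[fc' _] /profile_inj eq_prof.
have alt := fully_commutative_alternating affineA_le3 affineA_entry3P
  ord_pred_ordS_neq.
have {eq_prof} ww' := comm_equiv_eval (eq_prof (alt _ _ fc (reduced_wordP w))
  (alt _ _ fc' (reduced_wordP w'))).
by case: (reduced_wordP w) => <- _; case: (reduced_wordP w') => <- _.
Qed.

Lemma finite_profiles l : finite_set (profiles_of_sum l).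
Proof. by rewrite -fc_profile_image; exact/finite_image/finite_fc_of_length. Qed.

Lemma affineA_fc_countE l :
  affineA_fc_count n l = #|` fset_set (profiles_of_sum l)|%fset.
Proof.
rewrite /affineA_fc_count /fc_count -fc_profile_image.
apply/esym/fcard_eq.
- apply: finite_image; exact: finite_fc_of_length.
- exact: finite_fc_of_length.
- by apply: inj_card_eq; apply: fc_profile_inj.
Qed.

Definition shift d : profiles := ([ffun i => (d.1 i).+1], d.2).

Lemma shift_inj : injective shift.
Proof.
move=> [h f] [h' f'] [hh' ->]; congr pair; apply/ffunP => i.
by move/ffunP/(_ i): hh'; rewrite !ffunE => -[].
Qed.

Lemma sum_shift d : \sum_i (shift d).1 i = \sum_i d.1 i + n.
Proof.
under eq_bigr => i _ do rewrite ffunE -addn1.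
by rewrite big_split /= sum1_card card_ord.
Qed.

Lemma shift_profiles l : 0 < l ->
  ([set shift d | d in profiles_of_sum l] `<=` profiles_of_sum (l + n))%classic.
Proof.
move=> l0 _ [d [[ok nf pf] dl] <-]; split; last by rewrite sum_shift dl.
split=> //; last by move=> _; apply: pf; rewrite dl.
move=> i; have := ok i; rewrite !ffunE /= /step_ok.
by case: (d.2 i); lia.
Qed.

Definition lipschitz (h : 'I_n -> nat) :=
  forall i, h i <= (h (ordS i)).+1 /\ h (ordS i) <= (h i).+1.

Lemma heap_profile_lipschitz d : heap_profile d -> lipschitz d.1.
Proof. by case=> ok _ _ i; have := ok i; rewrite /step_ok; case: (d.2 i); lia. Qed.

Lemma lipschitz_iter h i r : lipschitz h ->
  h i <= h (iter r (@ordS n) i) + r /\ h (iter r (@ordS n) i) <= h i + r.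
Proof.
move=> lip; elim: r => [|r IH]; first by rewrite addn0.
by have := lip (iter r (@ordS n) i); rewrite iterS; lia.
Qed.

Lemma iter_ordS_id i : iter n (@ordS n) i = i.
Proof. by apply: val_inj; rewrite /= iter_ordS_val modnDr modn_small. Qed.

Lemma sum_around i (h : 'I_n -> nat) :
  \sum_j h j = \sum_(r < n) h (iter r (@ordS n) i).
Proof.
apply: (reindex_inj (h := fun r : 'I_n => iter r (@ordS n) i)) => r s /(congr1 val).
rewrite /= !iter_ordS_val => /eqP; rewrite eqn_modDl !modn_small // => /eqP.
exact: val_inj.
Qed.

(** Removing the two zeros at the ends of a tent and lowering the rest by 1 leaves
    the tent of N - 2, which accounts for N - 1 in the sum. *)
Lemma sum_tent N : \sum_(r < N.+1) minn r (N - r) = N./2 * uphalf N.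
Proof.
have [k] := ubnP N; elim: k N => // k IH [|[|N]] lt.
- by rewrite big_ord1.
- by rewrite !big_ord_recl big_ord0.
rewrite big_ord_recl big_ord_recr /= min0n add0n.
have -> : minn (bump 0 N.+1) (N.+2 - bump 0 N.+1) = 0 by rewrite /bump; lia.
under eq_bigr => r _.
  have -> : minn (bump 0 r) (N.+2 - bump 0 r) = minn r (N - r) + 1.
    by rewrite /bump; have := ltn_ord r; lia.
  over.
rewrite big_split /= IH ?sum1_card ?card_ord; lia.
Qed.

Local Notation peak := ((n.-1)./2 * uphalf n.-1).

Lemma sum_tent_n : \sum_(r < n) minn r (n.-1 - r) = peak.
Proof. by rewrite -[RHS]sum_tent prednK //; lia. Qed.

(** Going around the cycle from i to i bounds the values by min(r, n - r), at most
    1 above the tent. *)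
Lemma sum_le_of_zero h i : lipschitz h -> h i = 0 -> \sum_j h j <= peak + n.
Proof.
move=> lip hi; rewrite (sum_around i) -sum_tent_n.
rewrite -[X in _ + X]card_ord -sum1_card -big_split; apply: leq_sum => r _ /=.
have [_] := lipschitz_iter i r lip.
have [+ _] := lipschitz_iter (iter r (@ordS n) i) (n - r) lip.
rewrite -iterD subnK ?iter_ordS_id ?hi; last exact/ltnW.
by have := ltn_ord r; lia.
Qed.

(** Going around from the successor of i to i takes n - 1 steps, with zeros at both
    ends. *)
Lemma sum_le_of_zeros h i : lipschitz h -> h i = 0 -> h (ordS i) = 0 ->
  \sum_j h j <= peak.
Proof.
move=> lip hi hSi; rewrite (sum_around (ordS i)) -sum_tent_n.
apply: leq_sum => r _ /=.
have [_] := lipschitz_iter (ordS i) r lip.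
have [+ _] := lipschitz_iter (iter r (@ordS n) (ordS i)) (n.-1 - r) lip.
rewrite -iterD subnK; last by have := ltn_ord r; lia.
rewrite -(iterSr n.-1) prednK; last lia.
by rewrite iter_ordS_id hi hSi; lia.
Qed.

(** Subtracting 1 is possible as a zero would make the sum at most peak + n; it can
    only break the requirement that f be false on edges without occurrences, and
    two adjacent zeros would make the sum at most peak. *)
Lemma shift_profiles_onto l : peak < l ->
  (profiles_of_sum (l + n) `<=` [set shift d | d in profiles_of_sum l])%classic.
Proof.
move=> lt_l d' [hd' sd'].
have lip := heap_profile_lipschitz hd'.
have pos i : 0 < d'.1 i.
  by rewrite lt0n; apply/eqP => /(sum_le_of_zero lip); lia.
pose d : profiles := ([ffun i => (d'.1 i).-1], d'.2).
have d'E : d' = shift d.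
  rewrite [LHS]surjective_pairing /shift; congr pair; apply/ffunP => i.
  by rewrite !ffunE prednK.
have sd : \sum_i d.1 i = l by move: sd'; rewrite d'E sum_shift; lia.
have dE i : d.1 i = (d'.1 i).-1 by rewrite ffunE.
have lip_d : lipschitz d.1.
  by move=> i; have := lip i; rewrite !dE; have := pos i; have := pos (ordS i); lia.
exists d => //; split=> //; case: hd' => ok nf pf; split=> // [i|_]; last first.
  by apply: pf; rewrite sd'; lia.
have zeros : d.1 i = 0 -> d.1 (ordS i) = 0 -> False.
  by move=> di /(sum_le_of_zeros lip_d di); lia.
have := ok i; rewrite !dE in zeros *; have := pos i; have := pos (ordS i).
rewrite /step_ok /=; case: (d'.2 i); lia.
Qed.

(** The witness is the tent raised by 1, with f true on the edge from n - 1 to 0.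
    Both ends of that edge carry 1, so lowering by 1 leaves there an edge without
    occurrences whose f is true. *)
Lemma shift_profiles_proper :
  ~ (profiles_of_sum (peak + n) `<=`
     [set shift d | d in profiles_of_sum peak])%classic.
Proof.
pose tent (j : nat) := minn j (n.-1 - j).
pose d : profiles :=
  ([ffun j : 'I_n => (tent j).+1],
   [ffun j : 'I_n => (j.+1 == n) || (tent (ordS j) < tent j)]).
move=> /(_ d); case.
  split; last first.
    under eq_bigr => j _ do rewrite ffunE -addn1.
    by rewrite big_split /= sum_tent_n sum1_card card_ord.
  have tentS (j : 'I_n) : tent (ordS j) = if j.+1 == n then 0 else tent j.+1.
    by rewrite ordS_val; case: eqP; rewrite // /tent min0n.
  split.
  - move=> j; rewrite !ffunE tentS /step_ok; have := ltn_ord j.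
    by case: eqP => [jn|jn] /=; [|case: ifP]; rewrite /tent; lia.
  - have i0 : 0 < n by lia.
    exists (Ordinal i0); rewrite ffunE tentS /tent /=; lia.
  - have i1 : n.-1 < n by lia.
    by exists (Ordinal i1); rewrite ffunE /= prednK ?eqxx; lia.
move=> e [[ok _ _] _] eE.
have i1 : n.-1 < n by lia.
have := ok (Ordinal i1); rewrite /step_ok.
have -> : e.2 (Ordinal i1).
  by move/(congr1 snd): eE => /= ->; rewrite ffunE /= prednK ?eqxx; lia.
have -> : e.1 (Ordinal i1) = 0.
  move/(congr1 (fun x : profiles => x.1 (Ordinal i1))): eE.
  by rewrite !ffunE /tent /=; lia.
by [].
Qed.

Lemma affineA_fc_count_shift l :
  affineA_fc_count n l =
  #|` fset_set [set shift d | d in profiles_of_sum l]%classic|%fset.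
Proof.
rewrite affineA_fc_countE; apply/esym/fcard_eq.
- exact/finite_image/finite_profiles.
- exact: finite_profiles.
- by apply: inj_card_eq => d d' _ _; exact: shift_inj.
Qed.

Lemma affineA_fc_count_periodic l : peak < l ->
  affineA_fc_count n (l + n) = affineA_fc_count n l.
Proof.
move=> lt_l; rewrite [RHS]affineA_fc_count_shift affineA_fc_countE.
congr (#|` fset_set _|%fset); apply/seteqP; split; first exact: shift_profiles_onto.
by apply: shift_profiles; lia.
Qed.

Lemma affineA_fc_count_lt :
  affineA_fc_count n peak < affineA_fc_count n (peak + n).
Proof.
have peak0 : 0 < peak by rewrite muln_gt0 uphalf_gt0; lia.
rewrite affineA_fc_count_shift affineA_fc_countE.
have fin_l := finite_profiles (peak + n).
have fin_shift := finite_image shift (finite_profiles peak).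
apply: fproper_ltn_card; rewrite fproperE; apply/andP; split.
  by rewrite -fset_set_sub //; exact: shift_profiles.
by apply/negP; rewrite -fset_set_sub //; exact: shift_profiles_proper.
Qed.

End AffineA.

Theorem theorem2p3 (n : nat) (hn : 3 <= n) :
  let l0 := (n.-1)./2 * uphalf n.-1 in
  [/\ ultimately_periodic n (affineA_fc_count n),
      forall l : nat, l0.+1 <= l ->
        affineA_fc_count n (l + n) = affineA_fc_count n l
    & affineA_fc_count n (l0 + n) <> affineA_fc_count n l0].
Proof.
move=> l0; have periodic := affineA_fc_count_periodic hn.
split=> //; last first.
  by move=> eq_l0; have := affineA_fc_count_lt hn; rewrite -/l0 eq_l0 ltnn.
by split; [lia | exists l0.+1].
Qed.
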